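(* Let $\phi:\mathbb{D}\to\mathbb{D}$ and $\psi:\mathbb{D}\to\mathbb{C}$ be analytic such that $C_{\psi,\phi}$ is a bounded operator on $\mathcal{D}$, with $\psi\ne0$ (not identically zero) and $\phi(0)=0$. If $\phi$ is not a dilation map, then the numerical range $W(C_{\psi,\phi})$ contains $0$ in its interior.
   Context: $\mathbb{D}=\{z\in\mathbb{C}:|z|<1\}$. The Dirichlet space $\mathcal{D}$ is the Hilbert space of all holomorphic $f(z)=\sum_{n\ge0}\hat f_nz^n$ on $\mathbb{D}$ with $\sum_{n\ge 0}(n+1)|\hat f_n|^2<\infty$ (equivalently $\int_{\mathbb{D}}|f'|^2dA<\infty$), with inner product $\langle f,g\rangle_{\mathcal{D}}=\sum_{n\ge0}(n+1)\hat f_n\overline{\hat g_n}$. The weighted composition operator is $(C_{\psi,\phi}f)(z)=\psi(z)f(\phi(z))$. A dilation map is a map of the form $\phi(z)=tz$ with $t\in\overline{\mathbb{D}}$ (including $t=0$). The numerical range of a bounded operator $T$ on a Hilbert space $\mathcal{H}$ is $W(T)=\{\langle Tf,f\rangle:f\in\mathcal{H},\|f\|=1\}$; interior is taken in $\mathbb{C}$. *)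

(* Defs.v *)
From Stdlib Require Import Reals.
From Coquelicot Require Export Coquelicot.

Open Scope R_scope.

Definition unit_disk (z : C) : Prop := Cmod z < 1.

(* A function on the disk is represented by a total function [C -> C]; no
   definition below depends on its values outside the disk. *)
Definition holomorphic_on_disk (f : C -> C) : Prop :=
  forall z : C, unit_disk z -> ex_derive (K := C_AbsRing) (V := C_NormedModule) f z.

Definition power_series_on_disk (f : C -> C) (a : nat -> C) : Prop :=
  forall z : C, unit_disk z -> is_pseries (K := C_AbsRing) (V := C_NormedModule) a z (f z).

(* [iota P] is the unique element satisfying [P]; the coefficient sequence of a
   power series converging to [f] on the disk is unique. The value is only
   meaningful if such a series exists. *)
Definition taylor_coef (f : C -> C) (n : nat) : C :=
  iota (T := C_CompleteNormedModule)
    (fun c : C => exists a : nat -> C, power_series_on_disk f a /\ c = a n).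

(* Coquelicot's [Series] is restricted to real series; this is its complex
   analogue, meaningful for convergent series. *)
Definition CSeries (u : nat -> C) : C :=
  iota (T := C_CompleteNormedModule)
    (fun s : C => is_series (K := C_AbsRing) (V := C_NormedModule) u s).

Definition in_dirichlet (f : C -> C) : Prop :=
  holomorphic_on_disk f /\
  exists a : nat -> C,
    power_series_on_disk f a /\
    ex_series (K := R_AbsRing) (V := R_NormedModule)
      (fun n : nat => INR (S n) * Cmod (a n) ^ 2).

Definition dirichlet_inner (f g : C -> C) : C :=
  CSeries (fun n : nat =>
    (RtoC (INR (S n)) * (taylor_coef f n * Cconj (taylor_coef g n)))%C).

Definition dirichlet_norm (f : C -> C) : R := sqrt (Re (dirichlet_inner f f)).

Definition weighted_composition (psi phi f : C -> C) : C -> C :=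
  fun z : C => (psi z * f (phi z))%C.

(* Linearity is not required here: it is automatic for [weighted_composition]. *)
Definition bounded_on_dirichlet (T : (C -> C) -> (C -> C)) : Prop :=
  (forall f : C -> C, in_dirichlet f -> in_dirichlet (T f)) /\
  exists M : R, forall f : C -> C,
    in_dirichlet f -> dirichlet_norm (T f) <= M * dirichlet_norm f.

Definition numerical_range (T : (C -> C) -> (C -> C)) (w : C) : Prop :=
  exists f : C -> C,
    in_dirichlet f /\ dirichlet_norm f = 1 /\ w = dirichlet_inner (T f) f.

Definition is_dilation (phi : C -> C) : Prop :=
  exists t : C, Cmod t <= 1 /\ forall z : C, unit_disk z -> phi z = (t * z)%C.

Definition interior_point (S : C -> Prop) (w : C) : Prop :=
  locally (T := C_UniformSpace) w S.

(* Main.v *)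
Require Import Defs.
From Stdlib Require Import Reals.
From Coquelicot Require Import Coquelicot.
From Stdlib Require Import Lra Lia Arith Classical Wf_nat.

(** The operator maps [z^n] to [psi phi^n], and [phi 0 = 0], so in the orthonormal
    basis [z^n / sqrt (n + 1)] its matrix is lower triangular. Compressing it to two
    basis vectors gives a lower triangular 2 x 2 matrix with diagonal [a], [b] and
    lower left entry [c], whose numerical range is an elliptical disk with foci
    [a], [b] and minor axis [|c|]. If [|a| + |b| < |c|], this disk contains a neighbourhood
    of 0 ([elliptic_range_solution]). It therefore suffices to find an
    off-diagonal entry that dominates the two diagonal entries next to it
    ([interior_of_lower_triangular_pair]).

    If [psi 0 = 0], the whole diagonal vanishes, and the column of [z^0], which lists
    the coefficients of [psi], has a nonzero entry.

    If [psi 0 <> 0], write [phi z = lam z + mu z^(p+1) + O(z^(p+2))] with [p >= 1] and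
    [mu <> 0], which is possible because [phi] is not a dilation
    ([expansion_of_product_series], [dilation_of_factor]). The coefficients of
    [psi phi^n] at [z^n] and of [psi phi^(n+p)] at [z^(n+p)] are [lam^n psi_0] and
    [lam^(n+p) psi_0], whereas the coefficient of [psi phi^n] at [z^(n+p)] is
    [lam^n psi_p + n lam^(n-1) mu psi_0] ([coef_psi_pow]). Because of the factor [n]
    the latter dominates for large [n], and already for [n = 1] if [lam = 0]
    ([off_diagonal_dominates]).

    Coefficients are computed with [O]-estimates at the origin
    ([coef_of_vanishes]). To conclude that [phi] is a dilation once
    [psi (phi - lam z)] vanishes identically, one has to know that [psi] vanishes on no
    open set; this is the identity theorem, proved on a diameter of the disk by
    Taylor's formula ([real_power_series_zero_extends], [identity_at_0]). *)

(** * Complex series and power series on the disk *)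

Notation is_seriesC := (is_series (K := C_AbsRing) (V := C_NormedModule)).

Lemma is_seriesC_unique (u : nat -> C) (l1 l2 : C) :
  is_seriesC u l1 -> is_seriesC u l2 -> l1 = l2.
Proof.
intros H1 H2.
exact (filterlim_locally_unique (K := C_AbsRing) (V := C_NormedModule) _ _ _ H1 H2).
Qed.

Lemma CSeries_eq (u : nat -> C) (l : C) : is_seriesC u l -> CSeries u = l.
Proof.
intros H. unfold CSeries.
apply (iota_unique (V := C_CompleteNormedModule)); [|exact H].
intros y Hy. exact (is_seriesC_unique _ _ _ Hy H).
Qed.

Lemma is_series_Re (u : nat -> C) (l : C) :
  is_seriesC u l -> is_series (fun n => Re (u n)) (Re l).
Proof.
intros H P [eps HP].
assert (HS : forall n, sum_n (fun k => Re (u k)) n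
               = Re (sum_n (G := C_AbelianMonoid) u n)).
{ induction n as [|n IH]; [now rewrite !sum_O|].
  rewrite !sum_Sn, IH. reflexivity. }
assert (Hl : locally (T := C_UniformSpace) l (fun z => P (Re z))).
{ exists eps. intros z [Hz _]. now apply HP. }
destruct (H _ Hl) as [N HN]. exists N. intros n Hn.
rewrite HS. now apply HN.
Qed.

Lemma is_series_Im (u : nat -> C) (l : C) :
  is_seriesC u l -> is_series (fun n => Im (u n)) (Im l).
Proof.
intros H P [eps HP].
assert (HS : forall n, sum_n (fun k => Im (u k)) n
               = Im (sum_n (G := C_AbelianMonoid) u n)).
{ induction n as [|n IH]; [now rewrite !sum_O|].
  rewrite !sum_Sn, IH. reflexivity. }
assert (Hl : locally (T := C_UniformSpace) l (fun z => P (Im z))).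
{ exists eps. intros z [_ Hz]. now apply HP. }
destruct (H _ Hl) as [N HN]. exists N. intros n Hn.
rewrite HS. now apply HN.
Qed.

Lemma Cmod_le_Re_Im (z : C) : Cmod z <= Rabs (Re z) + Rabs (Im z).
Proof.
destruct z as [x y]. unfold Cmod, Re, Im; simpl fst; simpl snd.
rewrite <- (sqrt_Rsqr (Rabs x + Rabs y)).
2: { pose proof (Rabs_pos x); pose proof (Rabs_pos y); lra. }
apply sqrt_le_1_alt. unfold Rsqr.
pose proof (Rabs_pos x); pose proof (Rabs_pos y).
rewrite <- (pow2_abs x), <- (pow2_abs y). nra.
Qed.

Lemma Im_le_Cmod (z : C) : Rabs (Im z) <= Cmod z.
Proof.
pose proof (Rmax_Cmod z) as H.
pose proof (Rmax_r (Rabs (fst z)) (Rabs (snd z))). unfold Im. lra.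
Qed.

Lemma ex_series_bounded (u : nat -> R) :
  ex_series u -> exists M, forall n, Rabs (u n) <= M.
Proof.
intros H. apply ex_series_lim_0 in H.
assert (H1 : Un_cv u 0) by now apply is_lim_seq_Reals.
apply (fun H => CV_Cauchy u (exist _ 0 H)), cauchy_bound in H1.
assert (H2 : Un_cv (fun n => - u n) 0).
{ apply is_lim_seq_Reals. replace (Finite 0) with (Rbar_opp 0) by (simpl; f_equal; ring).
  now apply -> is_lim_seq_opp. }
apply (fun H => CV_Cauchy _ (exist _ 0 H)), cauchy_bound in H2.
destruct H1 as [M1 H1]. destruct H2 as [M2 H2].
exists (Rmax M1 M2). intros n.
assert (u n <= M1) by (apply H1; now exists n).
assert (- u n <= M2) by (apply H2; now exists n).
pose proof (Rmax_l M1 M2). pose proof (Rmax_r M1 M2).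
apply Rabs_le. lra.
Qed.

Lemma is_seriesC_bounded (u : nat -> C) (l : C) :
  is_seriesC u l -> exists M, forall n, Cmod (u n) <= M.
Proof.
intros H.
destruct (ex_series_bounded (fun n => Re (u n))) as [M1 H1].
{ exists (Re l). exact (is_series_Re _ _ H). }
destruct (ex_series_bounded (fun n => Im (u n))) as [M2 H2].
{ exists (Im l). exact (is_series_Im _ _ H). }
exists (M1 + M2). intros n. pose proof (Cmod_le_Re_Im (u n)).
specialize (H1 n). specialize (H2 n). lra.
Qed.

(** The constant 2 is the price of comparing the real and imaginary parts
    separately, which reduces complex series to real ones. *)
Lemma is_seriesC_norm_le (u : nat -> C) (l : C) (v : nat -> R) (S : R) :
  is_seriesC u l -> (forall n, Cmod (u n) <= v n) -> is_series v S ->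
  Cmod l <= 2 * S.
Proof.
assert (K : forall (w : nat -> R) (s : R), is_series w s -> (forall n, Rabs (w n) <= v n) ->
              is_series v S -> Rabs s <= S).
{ intros w s Hw Hle Hv.
  rewrite <- (is_series_unique _ _ Hw), <- (is_series_unique _ _ Hv).
  assert (Ha : ex_series (fun n => Rabs (w n))).
  { apply (ex_series_le (V := R_CompleteNormedModule) _ v); [|exists S; exact Hv].
    intros n. change (Rabs (Rabs (w n)) <= v n). rewrite Rabs_Rabsolu. apply Hle. }
  eapply Rle_trans; [now apply Series_Rabs|].
  apply Series_le; [|exists S; exact Hv].
  intros n. split; [apply Rabs_pos | apply Hle]. }
intros Hu Hle Hv.
assert (Rabs (Re l) <= S).
{ apply (K _ _ (is_series_Re _ _ Hu)); [|assumption].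
  intros n. eapply Rle_trans; [apply re_le_Cmod|apply Hle]. }
assert (Rabs (Im l) <= S).
{ apply (K _ _ (is_series_Im _ _ Hu)); [|assumption].
  intros n. eapply Rle_trans; [apply Im_le_Cmod|apply Hle]. }
pose proof (Cmod_le_Re_Im l). lra.
Qed.

Lemma is_seriesC_single (u : nat -> C) (n : nat) :
  (forall k, k <> n -> u k = RtoC 0) -> is_seriesC u (u n).
Proof.
intros H.
assert (H1 : forall k, (k < n)%nat -> sum_n (G := C_AbelianMonoid) u k = RtoC 0).
{ induction k as [|k IH]; intros Hk.
  - rewrite sum_O. apply H; lia.
  - rewrite sum_Sn, IH by lia. rewrite (H (S k)) by lia. apply Cplus_0_l. }
assert (H2 : forall d, sum_n (G := C_AbelianMonoid) u (d + n) = u n).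
{ induction d as [|d IH].
  - simpl. destruct n as [|n]; [apply sum_O|].
    rewrite sum_Sn, H1 by lia. apply Cplus_0_l.
  - simpl. rewrite sum_Sn, IH, (H (S (d + n))%nat) by lia. apply Cplus_0_r. }
intros P HP. exists n. intros m Hm.
replace m with ((m - n) + n)%nat by lia.
change (P (sum_n (G := C_AbelianMonoid) u (m - n + n))).
rewrite H2. exact (locally_singleton (T := C_NormedModule) _ _ HP).
Qed.

Lemma pow_n_Cpow (z : C) (n : nat) : pow_n (K := C_Ring) z n = Cpow z n.
Proof. induction n as [|n IH]; [reflexivity|]. simpl. now rewrite IH. Qed.

Lemma power_series_iff (f : C -> C) (a : nat -> C) :
  power_series_on_disk f a <->
  forall z, unit_disk z -> is_seriesC (fun n => (z ^ n * a n)%C) (f z).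
Proof.
split; intros H z Hz; specialize (H z Hz).
- apply is_series_ext with (2 := H). intros n. rewrite ?pow_n_Cpow; reflexivity.
- apply is_series_ext with (2 := H). intros n. rewrite ?pow_n_Cpow; reflexivity.
Qed.

Lemma power_series_ext (f g : C -> C) (a b : nat -> C) :
  (forall z, unit_disk z -> f z = g z) -> (forall n, a n = b n) ->
  power_series_on_disk f a -> power_series_on_disk g b.
Proof.
intros Hf Ha H z Hz. rewrite <- (Hf z Hz).
apply is_pseries_ext with (2 := H z Hz). exact Ha.
Qed.

Lemma power_series_plus (f g : C -> C) (a b : nat -> C) :
  power_series_on_disk f a -> power_series_on_disk g b ->
  power_series_on_disk (fun z => f z + g z)%C (fun n => a n + b n)%C.
Proof.
intros H1 H2 z Hz. exact (is_pseries_plus _ _ _ _ _ (H1 z Hz) (H2 z Hz)).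
Qed.

Lemma power_series_scal (c : C) (f : C -> C) (a : nat -> C) :
  power_series_on_disk f a ->
  power_series_on_disk (fun z => c * f z)%C (fun n => c * a n)%C.
Proof.
intros H z Hz. apply (is_pseries_scal c a z (f z)); [apply Cmult_comm | now apply H].
Qed.

Lemma power_series_shift (n : nat) (f : C -> C) (a : nat -> C) :
  power_series_on_disk f a ->
  power_series_on_disk (fun z => z ^ n * f z)%C
    (fun k => if le_lt_dec n k then a (k - n)%nat else RtoC 0).
Proof.
intros H.
apply power_series_ext with (fun z => z ^ n * f z)%C
  (PS_incr_n (K := C_AbsRing) (V := C_NormedModule) a n).
- reflexivity.
- intros k. now rewrite PS_incr_n_simplify.
- intros z Hz. rewrite <- pow_n_Cpow.
  exact (is_pseries_incr_n a n z (f z) (H z Hz)).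
Qed.

Lemma power_series_monomial (n : nat) :
  power_series_on_disk (fun z => z ^ n)%C
    (fun k => if Nat.eq_dec k n then RtoC 1 else RtoC 0).
Proof.
apply power_series_iff. intros z _.
set (u := fun k => (z ^ k * (if Nat.eq_dec k n then RtoC 1 else RtoC 0))%C).
replace (z ^ n)%C with (u n).
2: { unfold u. destruct (Nat.eq_dec n n); [apply Cmult_1_r | lia]. }
apply is_seriesC_single. intros k Hk. unfold u.
destruct (Nat.eq_dec k n); [lia|]. apply Cmult_0_r.
Qed.

(** * Vanishing order at the origin *)

(** [f = O(z^N)] at the origin. The origin itself is left out of the condition,
    so that a factor [z] can be cancelled whatever the value of [f] there. *)
Definition vanishes_to_order (N : nat) (f : C -> C) : Prop :=
  exists M d : R, 0 < d /\
    forall z, 0 < Cmod z < d -> Cmod (f z) <= M * Cmod z ^ N.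

Lemma vanishes_ext (N : nat) (f g : C -> C) :
  (forall z, unit_disk z -> f z = g z) ->
  vanishes_to_order N f -> vanishes_to_order N g.
Proof.
intros H (M & d & Hd & Hf). exists M, (Rmin d 1). split.
{ apply Rmin_pos; lra. }
intros z [Hz0 Hz]. pose proof (Rmin_l d 1). pose proof (Rmin_r d 1).
rewrite <- H by (unfold unit_disk; lra). apply Hf; lra.
Qed.

Lemma vanishes_bound_nonneg (N : nat) (f : C -> C) :
  vanishes_to_order N f ->
  exists M d : R, 0 <= M /\ 0 < d <= 1 /\
    forall z, 0 < Cmod z < d -> Cmod (f z) <= M * Cmod z ^ N.
Proof.
intros (M & d & Hd & Hf). exists (Rmax M 0), (Rmin d 1).
repeat split; [apply Rmax_r | apply Rmin_pos; lra | apply Rmin_r |].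
intros z [Hz0 Hz]. pose proof (Rmin_l d 1).
eapply Rle_trans; [apply Hf; lra|].
apply Rmult_le_compat_r; [apply pow_le; lra | apply Rmax_l].
Qed.

Lemma vanishes_plus (N : nat) (f g : C -> C) :
  vanishes_to_order N f -> vanishes_to_order N g ->
  vanishes_to_order N (fun z => f z + g z)%C.
Proof.
intros (M1 & d1 & Hd1 & H1) (M2 & d2 & Hd2 & H2).
exists (M1 + M2), (Rmin d1 d2). split; [apply Rmin_pos; lra|].
intros z [Hz0 Hz]. pose proof (Rmin_l d1 d2). pose proof (Rmin_r d1 d2).
eapply Rle_trans; [apply Cmod_triangle|].
specialize (H1 z ltac:(lra)). specialize (H2 z ltac:(lra)). lra.
Qed.

Lemma vanishes_mult (N1 N2 : nat) (f g : C -> C) :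
  vanishes_to_order N1 f -> vanishes_to_order N2 g ->
  vanishes_to_order (N1 + N2) (fun z => f z * g z)%C.
Proof.
intros Hf Hg.
destruct (vanishes_bound_nonneg _ _ Hf) as (M1 & d1 & HM1 & Hd1 & H1).
destruct (vanishes_bound_nonneg _ _ Hg) as (M2 & d2 & HM2 & Hd2 & H2).
exists (M1 * M2), (Rmin d1 d2). split; [apply Rmin_pos; lra|].
intros z [Hz0 Hz]. pose proof (Rmin_l d1 d2). pose proof (Rmin_r d1 d2).
rewrite Cmod_mult, pow_add.
replace (M1 * M2 * (Cmod z ^ N1 * Cmod z ^ N2))
  with ((M1 * Cmod z ^ N1) * (M2 * Cmod z ^ N2)) by ring.
apply Rmult_le_compat; try apply Cmod_ge_0; [apply H1 | apply H2]; lra.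
Qed.

Lemma vanishes_weaken (N1 N2 : nat) (f : C -> C) :
  (N2 <= N1)%nat -> vanishes_to_order N1 f -> vanishes_to_order N2 f.
Proof.
intros HN Hf.
destruct (vanishes_bound_nonneg _ _ Hf) as (M & d & HM & Hd & H).
exists M, d. split; [lra|]. intros z Hz.
eapply Rle_trans; [now apply H|]. apply Rmult_le_compat_l; [lra|].
replace N1 with (N2 + (N1 - N2))%nat by lia. rewrite pow_add.
rewrite <- (Rmult_1_r (Cmod z ^ N2)) at 2.
apply Rmult_le_compat_l; [apply pow_le; lra|].
rewrite <- (pow1 (N1 - N2)). apply pow_incr. lra.
Qed.

Lemma vanishes_monomial (c : C) (n : nat) :
  vanishes_to_order n (fun z => c * z ^ n)%C.
Proof.
exists (Cmod c), 1. split; [lra|]. intros z _.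
rewrite Cmod_mult, Cmod_pow. lra.
Qed.

Lemma vanishes_const (c : C) : vanishes_to_order 0 (fun _ => c).
Proof. exists (Cmod c), 1. split; [lra|]. intros z _. simpl. lra. Qed.

(** The terms at [z = 2/3] are bounded, so on [|z| < 1/2] the series is dominated
    by a geometric one of ratio [(1/2) / (2/3) = 3/4]. *)
Lemma power_series_bounded (f : C -> C) (a : nat -> C) :
  power_series_on_disk f a -> vanishes_to_order 0 f.
Proof.
intros H. rewrite power_series_iff in H.
destruct (is_seriesC_bounded _ _ (H (RtoC (2/3)) ltac:(unfold unit_disk; rewrite Cmod_R, Rabs_pos_eq; lra)))
  as [M HM].
exists (2 * (M * / (1 - 3/4))), (1/2). split; [lra|]. intros z Hz.
simpl. rewrite Rmult_1_r.
apply is_seriesC_norm_le with (1 := H z ltac:(unfold unit_disk; lra))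
  (v := fun n => M * (3/4) ^ n).
2: { exact (is_series_scal M _ _ (is_series_geom (3/4) ltac:(rewrite Rabs_pos_eq; lra))). }
intros n. specialize (HM n). rewrite Cmod_mult, Cmod_pow in HM |- *.
rewrite Cmod_R, Rabs_pos_eq in HM by lra.
pose proof (Cmod_ge_0 (a n)) as Ha.
replace (3/4) with (/ (2/3) * (1/2)) by field.
rewrite Rpow_mult_distr, pow_inv.
assert (H23 : 0 < (2/3)^n) by (apply pow_lt; lra).
assert (Hz2 : Cmod z ^ n <= (1/2)^n) by (apply pow_incr; lra).
replace (M * (/ (2/3)^n * (1/2)^n)) with ((1/2)^n * (M / (2/3)^n)) by (field; lra).
apply Rmult_le_compat; [apply pow_le; lra | lra | lra |].
apply Rmult_le_reg_l with ((2/3)^n); [lra|].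
replace ((2/3)^n * (M / (2/3)^n)) with M by (field; lra). lra.
Qed.

Lemma is_seriesC_at_0 (a : nat -> C) :
  is_seriesC (fun n => RtoC 0 ^ n * a n)%C (a 0%nat).
Proof.
set (u := fun n => (RtoC 0 ^ n * a n)%C).
replace (a 0%nat) with (u 0%nat) by (unfold u; simpl; ring).
apply is_seriesC_single. intros [|k] Hk; [lia|]. unfold u. simpl. ring.
Qed.

Lemma power_series_at_0 (f : C -> C) (a : nat -> C) :
  power_series_on_disk f a -> f (RtoC 0) = a 0%nat.
Proof.
intros H. rewrite power_series_iff in H.
apply (is_seriesC_unique (fun n => (RtoC 0 ^ n * a n)%C)).
- apply H. unfold unit_disk. rewrite Cmod_0. lra.
- apply is_seriesC_at_0.
Qed.

Lemma power_series_tail (f : C -> C) (a : nat -> C) :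
  power_series_on_disk f a ->
  exists g, power_series_on_disk g (fun n => a (S n)) /\
    forall z, unit_disk z -> f z = (a 0%nat + z * g z)%C.
Proof.
intros H.
exists (fun z => if Ceq_dec z (RtoC 0) then a 1%nat else (/ z * (f z - a 0%nat))%C).
split.
- intros z Hz. destruct (Ceq_dec z (RtoC 0)) as [->|Hz0].
  + apply is_series_ext with (2 := is_seriesC_at_0 (fun n => a (S n))).
    intros n. rewrite <- pow_n_Cpow. reflexivity.
  + apply (is_pseries_decr_1 (K := C_AbsRing) (V := C_NormedModule) a z (/ z)%C (f z)).
    * now apply Cinv_l.
    * now apply H.
- intros z Hz. destruct (Ceq_dec z (RtoC 0)) as [->|Hz0].
  + rewrite (power_series_at_0 f a H). ring.
  + now field.
Qed.

Lemma vanishes_div (N : nat) (f : C -> C) :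
  vanishes_to_order (S N) (fun z => z * f z)%C -> vanishes_to_order N f.
Proof.
intros (M & d & Hd & H). exists M, d. split; [lra|]. intros z Hz.
specialize (H z Hz). rewrite Cmod_mult in H. simpl in H.
apply Rmult_le_reg_l with (Cmod z); lra.
Qed.

Lemma vanishes_1_const (c : C) : vanishes_to_order 1 (fun _ => c) -> c = RtoC 0.
Proof.
intros H. destruct (vanishes_bound_nonneg _ _ H) as (M & d & HM & Hd & Hc).
destruct (Req_dec (Cmod c) 0) as [E|E]; [now apply Cmod_eq_0|exfalso].
pose proof (Cmod_ge_0 c).
set (t := Rmin (d/2) (Cmod c / (2 * (M + 1)))).
assert (Ht : 0 < t).
{ apply Rmin_pos; [lra|]. apply Rdiv_lt_0_compat; lra. }
specialize (Hc (RtoC t)). rewrite Cmod_R, Rabs_pos_eq in Hc by lra.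
assert (t <= d/2) by apply Rmin_l.
assert (H2 : t <= Cmod c / (2 * (M + 1))) by apply Rmin_r.
specialize (Hc ltac:(lra)). rewrite pow_1 in Hc.
assert ((M + 1) * t <= Cmod c / 2).
{ apply Rmult_le_compat_l with (r := M + 1) in H2; [|lra].
  replace ((M + 1) * (Cmod c / (2 * (M + 1)))) with (Cmod c / 2) in H2 by (field; lra).
  lra. }
nra.
Qed.

(** The link from analysis to algebra: an [O]-estimate, which behaves well under
    products and powers, determines low-order coefficients, so no Cauchy product
    of power series is ever formed. The proof peels off one coefficient at a
    time: [f = a_0 + z g] with [g] bounded forces [a_0 = 0], and then [g] vanishes
    to one order less. *)
Lemma coef_of_vanishes (N : nat) (f : C -> C) (a : nat -> C) :
  power_series_on_disk f a -> vanishes_to_order N f ->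
  forall k, (k < N)%nat -> a k = RtoC 0.
Proof.
revert f a. induction N as [|N IH]; intros f a Hf Hv k Hk; [lia|].
destruct (power_series_tail f a Hf) as (g & Hg & Hfg).
assert (Ha : a 0%nat = RtoC 0).
{ apply vanishes_1_const.
  apply vanishes_ext with (fun z => f z + (RtoC (-1) * z ^ 1) * g z)%C.
  { intros z Hz. rewrite (Hfg z Hz). simpl. ring. }
  apply vanishes_plus; [now apply vanishes_weaken with (2 := Hv); lia|].
  apply (vanishes_mult 1 0); [apply vanishes_monomial|].
  now apply power_series_bounded with (1 := Hg). }
destruct k as [|k]; [assumption|].
apply (IH g (fun n => a (S n))); [assumption| |lia].
apply vanishes_div. apply vanishes_ext with (2 := Hv).
intros z Hz. rewrite (Hfg z Hz), Ha. ring.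
Qed.

Lemma vanishes_of_coef (N : nat) (f : C -> C) (a : nat -> C) :
  power_series_on_disk f a -> (forall k, (k < N)%nat -> a k = RtoC 0) ->
  vanishes_to_order N f.
Proof.
revert f a. induction N as [|N IH]; intros f a Hf Ha.
{ now apply power_series_bounded with a. }
destruct (power_series_tail f a Hf) as (g & Hg & Hfg).
apply vanishes_ext with (fun z => (1 * z ^ 1) * g z)%C.
{ intros z Hz. rewrite (Hfg z Hz), Ha by lia. simpl. ring. }
apply (vanishes_mult 1 N); [apply vanishes_monomial|].
apply (IH g (fun n => a (S n))); [assumption|]. intros k Hk. apply Ha. lia.
Qed.

Lemma vanishes_leading_term (N : nat) (f : C -> C) (a : nat -> C) :
  power_series_on_disk f a -> (forall k, (k < N)%nat -> a k = RtoC 0) ->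
  vanishes_to_order (S N) (fun z => f z - a N * z ^ N)%C.
Proof.
intros Hf Ha.
apply vanishes_of_coef with
  (fun k => a k + (- a N) * (if Nat.eq_dec k N then RtoC 1 else RtoC 0))%C.
{ apply power_series_ext with (fun z => f z + (- a N) * z ^ N)%C
    (fun k => a k + (- a N) * (if Nat.eq_dec k N then RtoC 1 else RtoC 0))%C.
  - intros z _. ring.
  - reflexivity.
  - apply power_series_plus; [assumption|]. apply power_series_scal.
    apply power_series_monomial. }
intros k Hk. destruct (Nat.eq_dec k N) as [->|Hn]; [ring|].
rewrite Ha by lia. ring.
Qed.

Lemma power_series_coef_unique (f : C -> C) (a b : nat -> C) :
  power_series_on_disk f a -> power_series_on_disk f b -> forall n, a n = b n.
Proof.
intros Ha Hb n. apply Ceq_minus.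
apply (coef_of_vanishes (S n) (fun _ => RtoC 0) (fun k => a k - b k)%C); [| |lia].
- apply power_series_ext with (fun z => f z + RtoC (-1) * f z)%C
    (fun k => a k + RtoC (-1) * b k)%C.
  + intros z _. ring.
  + intros k. ring.
  + apply power_series_plus; [assumption|]. now apply power_series_scal.
- exists 0, 1. split; [lra|]. intros z _. rewrite Cmod_0. lra.
Qed.

(** Uniqueness of coefficients makes the description operator in [taylor_coef]
    meaningful. *)
Lemma taylor_coef_eq (f : C -> C) (a : nat -> C) :
  power_series_on_disk f a -> forall n, taylor_coef f n = a n.
Proof.
intros H n. unfold taylor_coef.
apply (iota_unique (V := C_CompleteNormedModule)).
- intros y (b & Hb & ->). now apply power_series_coef_unique with f.
- now exists a.
Qed.

(** * Functions with two terms in the Dirichlet space *)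

Lemma ex_derive_C_monomial (c : C) (n : nat) (z : C) :
  ex_derive (K := C_AbsRing) (V := C_NormedModule) (fun w => c * w ^ n)%C z.
Proof.
apply ex_derive_ext with
  (fun w : C_AbsRing => scal (V := C_NormedModule) (w ^ n)%C c).
{ intros w. exact (Cmult_comm _ _). }
apply (ex_derive_scal_l (K := C_AbsRing) (V := C_NormedModule)).
induction n as [|n [l Hl]].
- exists zero. exact (is_derive_const (V := AbsRing_NormedModule C_AbsRing) (RtoC 1) z).
- eexists. apply (is_derive_mult (K := C_AbsRing) (fun w => w) (fun w => w ^ n)%C z).
  + apply is_derive_id.
  + exact Hl.
  + intros; apply Cmult_comm.
Qed.

Definition two_terms (x y : C) (n j : nat) : C -> C :=
  fun z => (x * z ^ n + y * z ^ j)%C.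

Definition two_terms_coef (x y : C) (n j k : nat) : C :=
  (x * (if Nat.eq_dec k n then RtoC 1 else RtoC 0)
   + y * (if Nat.eq_dec k j then RtoC 1 else RtoC 0))%C.

Lemma power_series_two_terms (x y : C) (n j : nat) :
  power_series_on_disk (two_terms x y n j) (two_terms_coef x y n j).
Proof.
apply power_series_plus; apply power_series_scal; apply power_series_monomial.
Qed.

Lemma in_dirichlet_two_terms (x y : C) (n j : nat) :
  in_dirichlet (two_terms x y n j).
Proof.
split.
- intros z _.
  apply (ex_derive_plus (K := C_AbsRing) (V := C_NormedModule)
         (fun w => x * w ^ n)%C (fun w => y * w ^ j)%C); apply ex_derive_C_monomial.
- exists (two_terms_coef x y n j). split; [apply power_series_two_terms|].
  set (N := S (n + j)).
  apply (ex_series_incr_n _ N).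
  exists 0. apply is_series_ext with (fun _ => 0).
  { intros k. unfold two_terms_coef.
    destruct (Nat.eq_dec (N + k) n); [unfold N in *; lia|].
    destruct (Nat.eq_dec (N + k) j); [unfold N in *; lia|].
    replace (x * 0 + y * 0)%C with (RtoC 0) by ring. rewrite Cmod_0. simpl.
    ring. }
  intros P HP. exists 0%nat. intros m _.
  change (P (sum_n (fun _ => 0) m)). rewrite sum_n_const, Rmult_0_r.
  exact (locally_singleton _ _ HP).
Qed.

Lemma Cconj_RtoC (r : R) : Cconj (RtoC r) = RtoC r.
Proof. unfold Cconj, RtoC. simpl. now rewrite Ropp_0. Qed.

Lemma dirichlet_inner_two_terms (g : C -> C) (c : nat -> C) (x y : C) (n j : nat) :
  n <> j -> power_series_on_disk g c ->
  dirichlet_inner g (two_terms x y n j) =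
  (RtoC (INR (S n)) * (c n * Cconj x) + RtoC (INR (S j)) * (c j * Cconj y))%C.
Proof.
intros Hnj Hg. apply CSeries_eq.
set (u := fun (i : nat) (v : C) (k : nat) => 
   (RtoC (INR (S k)) * (c k * (if Nat.eq_dec k i then Cconj v else RtoC 0)))%C).
assert (Hu : forall i v, is_seriesC (u i v) (RtoC (INR (S i)) * (c i * Cconj v))%C).
{ intros i v. replace (RtoC (INR (S i)) * (c i * Cconj v))%C with (u i v i).
  2: { unfold u. destruct (Nat.eq_dec i i); [reflexivity|lia]. }
  apply is_seriesC_single. intros k Hk. unfold u.
  destruct (Nat.eq_dec k i); [lia|]. ring. }
apply is_series_ext with (2 := is_series_plus _ _ _ _ (Hu n x) (Hu j y)).
intros k. rewrite (taylor_coef_eq _ _ Hg), (taylor_coef_eq _ _ (power_series_two_terms x y n j)).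
change (u n x k + u j y k =
 RtoC (INR (S k)) * (c k * Cconj (two_terms_coef x y n j k)))%C.
unfold u, two_terms_coef.
rewrite Cplus_conj, !Cmult_conj.
destruct (Nat.eq_dec k n); destruct (Nat.eq_dec k j); rewrite !Cconj_RtoC; ring.
Qed.

Lemma dirichlet_norm_two_terms (x y : C) (n j : nat) :
  n <> j -> INR (S n) * Cmod x ^ 2 + INR (S j) * Cmod y ^ 2 = 1 ->
  dirichlet_norm (two_terms x y n j) = 1.
Proof.
intros Hnj H. unfold dirichlet_norm.
rewrite (dirichlet_inner_two_terms _ _ x y n j Hnj (power_series_two_terms x y n j)).
unfold two_terms_coef.
destruct (Nat.eq_dec n n); [|lia]. destruct (Nat.eq_dec n j); [lia|].
destruct (Nat.eq_dec j n); [lia|]. destruct (Nat.eq_dec j j); [|lia].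
replace (x * 1 + y * 0)%C with x by ring. replace (x * 0 + y * 1)%C with y by ring.
rewrite <- !Cmod2_conj, <- !RtoC_mult, <- RtoC_plus, re_RtoC, H. apply sqrt_1.
Qed.

(** * The numerical range of a lower triangular 2 x 2 matrix *)

(** The right-hand side is the value at the unit vector
    [(sqrt (1 - t), sqrt t * conj v)] of the quadratic form of the matrix with
    rows [(a, 0)] and [(c, b)]. For fixed [t] it describes, as [v] turns, the circle of
    centre [(1 - t) a + t b] and radius [|c| sqrt (t (1 - t))]. At [t = 0] this circle is
    the point [a]; at [t = 1/2] its radius [|c| / 2] exceeds the distance from [w] to
    its centre. By the intermediate value theorem some circle in between
    passes through [w]. *)
Lemma elliptic_range_solution (a b c w : C) :
  Cmod a + Cmod b + 2 * Cmod w < Cmod c ->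
  exists (t : R) (v : C), 0 <= t <= 1 /\ Cmod v = 1 /\
    w = (RtoC (1 - t) * a + RtoC t * b + RtoC (sqrt (t * (1 - t))) * (c * v))%C.
Proof.
intros H.
assert (Hw := Cmod_ge_0 w). assert (Ha := Cmod_ge_0 a). assert (Hb := Cmod_ge_0 b).
set (L := fun t : R => (w - RtoC (1 - t) * a - RtoC t * b)%C).
(* The radius and the distance are compared through their squares, which are
   polynomials in t and hence continuous on the whole line. *)
set (h := fun t : R => Cmod c ^ 2 * (t * (1 - t))
  - (Re w - (1 - t) * Re a - t * Re b) ^ 2 - (Im w - (1 - t) * Im a - t * Im b) ^ 2).
assert (Hh : forall t, h t = Cmod c ^ 2 * (t * (1 - t)) - Cmod (L t) ^ 2).
{ intros t. rewrite (Cmod2_alt (L t)). unfold h, L, Cminus.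
  rewrite !re_plus, !im_plus, !re_opp, !im_opp, !re_scal_l, !im_scal_l. ring. }
assert (Hcont : continuity h) by (unfold h; reg).
assert (H0 : h 0 <= 0).
{ rewrite Hh. pose proof (pow2_ge_0 (Cmod (L 0))). lra. }
assert (H1 : 0 <= h (1/2)).
{ rewrite Hh.
  assert (Cmod (L (1/2)) <= Cmod c / 2).
  { unfold L, Cminus. eapply Rle_trans; [apply Cmod_triangle|].
    rewrite Cmod_opp, Cmod_mult, Cmod_R, Rabs_pos_eq by lra.
    eapply Rle_trans; [apply Rplus_le_compat_r, Cmod_triangle|].
    rewrite Cmod_opp, Cmod_mult, Cmod_R, Rabs_pos_eq by lra. lra. }
  pose proof (Cmod_ge_0 (L (1/2))). nra. }
destruct (IVT_gen h 0 (1/2) 0 Hcont) as (t & Ht & Hht).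
{ rewrite Rmin_left, Rmax_right by lra. lra. }
rewrite Rmin_left, Rmax_right in Ht by lra.
rewrite Hh in Hht.
assert (Hs : 0 <= t * (1 - t)) by nra.
assert (HL : Cmod (L t) = sqrt (t * (1 - t)) * Cmod c).
{ apply Rsqr_inj; [apply Cmod_ge_0 | apply Rmult_le_pos; [apply sqrt_pos|apply Cmod_ge_0] |].
  rewrite Rsqr_mult, Rsqr_sqrt by assumption. unfold Rsqr. nra. }
assert (Hc0 : c <> RtoC 0) by (apply Cmod_gt_0; lra).
destruct (Req_dec (sqrt (t * (1 - t))) 0) as [E|E].
(* The circle is a point: any direction v will do. *)
- exists t, (RtoC 1). repeat split; [lra|lra|apply Cmod_1|].
  rewrite E, Rmult_0_l in HL. apply Cmod_eq_0 in HL. rewrite E.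
  unfold L in HL. replace w with ((w - RtoC (1 - t) * a - RtoC t * b)
   + (RtoC (1 - t) * a + RtoC t * b))%C at 1 by ring. rewrite HL. ring.
- assert (E' : RtoC (sqrt (t * (1 - t))) <> RtoC 0) by (intros F; now apply RtoC_inj in F).
  exists t, (L t / (RtoC (sqrt (t * (1 - t))) * c))%C. repeat split; [lra|lra| |].
  + rewrite Cmod_div by now apply Cmult_neq_0.
    rewrite HL, Cmod_mult, Cmod_R, Rabs_pos_eq by apply sqrt_pos.
    field. split; [lra|assumption].
  + unfold L. field. now split.
Qed.

(** Compression of the operator to the span of [z^n] and [z^j]. In the orthonormal
    basis [z^n / sqrt (n + 1)] its off-diagonal entry is [P j] times
    [sqrt ((j + 1) / (n + 1)) >= 1], so the hypothesis on the coefficients of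
    [psi phi^n] and [psi phi^j] carries over to the matrix entries. *)
Lemma interior_of_lower_triangular_pair (phi psi : C -> C) (n j : nat) (P Q : nat -> C) :
  (n < j)%nat ->
  power_series_on_disk (fun z => psi z * phi z ^ n)%C P ->
  power_series_on_disk (fun z => psi z * phi z ^ j)%C Q ->
  Q n = RtoC 0 ->
  Cmod (P n) + Cmod (Q j) < Cmod (P j) ->
  interior_point (numerical_range (weighted_composition psi phi)) (RtoC 0).
Proof.
intros Hnj HP HQ HQn Hlt.
set (rn := sqrt (INR (S n))). set (rj := sqrt (INR (S j))).
assert (Hn : 0 < INR (S n)) by (apply lt_0_INR; lia).
assert (Hj : 0 < INR (S j)) by (apply lt_0_INR; lia).
assert (Hrn : 0 < rn) by now apply sqrt_lt_R0.
assert (Hrj : 0 < rj) by now apply sqrt_lt_R0.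
assert (Hrn2 : rn * rn = INR (S n)) by (apply sqrt_sqrt; lra).
assert (Hrj2 : rj * rj = INR (S j)) by (apply sqrt_sqrt; lra).
set (c := (RtoC (rj / rn) * P j)%C).
assert (Hc : Cmod (P j) <= Cmod c).
{ unfold c. rewrite Cmod_mult, Cmod_R, Rabs_pos_eq by (apply Rlt_le, Rdiv_lt_0_compat; lra).
  rewrite <- (Rmult_1_l (Cmod (P j))) at 1.
  apply Rmult_le_compat_r; [apply Cmod_ge_0|].
  apply Rmult_le_reg_r with rn; [lra|]. unfold Rdiv.
  rewrite Rmult_assoc, Rinv_l, Rmult_1_l, Rmult_1_r by lra.
  apply sqrt_le_1_alt, le_INR; lia. }
assert (Heps : 0 < (Cmod c - Cmod (P n) - Cmod (Q j)) / 4) by lra.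
(* The gap is divided by 4 because |w| is bounded by |Re w| + |Im w|, each less
   than the radius, and 2 |w| has to stay below the gap. *)
exists (mkposreal _ Heps). intros w Hball.
assert (Hw : 2 * Cmod w < Cmod c - Cmod (P n) - Cmod (Q j)).
{ destruct Hball as [H1 H2].
  change (Rabs (Re w - 0) < (Cmod c - Cmod (P n) - Cmod (Q j)) / 4) in H1.
  change (Rabs (Im w - 0) < (Cmod c - Cmod (P n) - Cmod (Q j)) / 4) in H2.
  rewrite Rminus_0_r in H1, H2. pose proof (Cmod_le_Re_Im w). lra. }
destruct (elliptic_range_solution (P n) (Q j) c w ltac:(lra)) as (t & v & Ht & Hv & Hwt).
set (x := RtoC (sqrt (1 - t) / rn)). set (y := (RtoC (sqrt t / rj) * Cconj v)%C).
assert (Ht1 : sqrt (1 - t) * sqrt (1 - t) = 1 - t) by (apply sqrt_sqrt; lra).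
assert (Ht2 : sqrt t * sqrt t = t) by (apply sqrt_sqrt; lra).
exists (two_terms x y n j). split; [apply in_dirichlet_two_terms|]. split.
- apply dirichlet_norm_two_terms; [lia|].
  unfold x, y. rewrite Cmod_mult, Cmod_conj, Hv, !Cmod_R, Rmult_1_r, !pow2_abs.
  rewrite <- Hrn2, <- Hrj2.
  transitivity (sqrt (1 - t) * sqrt (1 - t) + sqrt t * sqrt t); [field|]; lra.
- rewrite (dirichlet_inner_two_terms _ (fun k => x * P k + y * Q k)%C); [|lia|].
  + unfold x at 2, y at 3. rewrite Cmult_conj, Cconj_conj, !Cconj_RtoC, HQn.
    rewrite Hwt, sqrt_mult by lra. unfold c, x.
    rewrite <- Hrn2, <- Hrj2.
    transitivity (RtoC (sqrt (1 - t) * sqrt (1 - t)) * P n + RtoC (sqrt t * sqrt t) * Q j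
      + RtoC (sqrt t * sqrt (1 - t)) * (RtoC (rj / rn) * P j * v))%C.
    { now rewrite Ht1, Ht2. }
    assert (Hvv : (Cconj v * v)%C = RtoC 1).
    { rewrite Cmult_comm, <- Cmod2_conj, Hv. f_equal. ring. }
    assert (E1 : RtoC rn <> RtoC 0) by (intros F; apply RtoC_inj in F; lra).
    assert (E2 : RtoC rj <> RtoC 0) by (intros F; apply RtoC_inj in F; lra).
    unfold y. rewrite !RtoC_div, !RtoC_mult by lra.
    replace (RtoC (sqrt t) * RtoC (sqrt t) * Q j)%C
      with (RtoC (sqrt t) * RtoC (sqrt t) * Q j * (Cconj v * v))%C
      by (rewrite Hvv; ring).
    field. now split.
  + apply power_series_ext with
      (fun z => x * (psi z * phi z ^ n) + y * (psi z * phi z ^ j))%C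
      (fun k => x * P k + y * Q k)%C.
    * intros z _. unfold weighted_composition, two_terms. ring.
    * reflexivity.
    * apply power_series_plus; now apply power_series_scal.
Qed.

(** * Coefficients of the functions psi phi^n *)

Lemma vanishes_of_expansion (phi : C -> C) (lam mu : C) (p : nat) :
  vanishes_to_order (S (S p)) (fun z => phi z - lam * z - mu * z ^ (S p))%C ->
  vanishes_to_order 1 phi.
Proof.
intros Hphi.
apply vanishes_ext with (fun z => (phi z - lam * z - mu * z ^ (S p))
   + (lam * z ^ 1 + mu * z ^ (S p)))%C.
{ intros z _. rewrite Cpow_1_r. ring. }
apply vanishes_plus; [apply vanishes_weaken with (2 := Hphi); lia|].
apply vanishes_plus; [apply vanishes_monomial|].
apply vanishes_weaken with (2 := vanishes_monomial mu (S p)); lia.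
Qed.

(** The binomial expansion of [phi^m], with [m = S n] so that the exponent [m - 1] of
    [lam] makes sense also for [lam = 0]; only its first two terms matter. *)
Lemma expansion_pow (phi : C -> C) (lam mu : C) (p n : nat) :
  (1 <= p)%nat ->
  vanishes_to_order (S (S p)) (fun z => phi z - lam * z - mu * z ^ (S p))%C ->
  vanishes_to_order (S (S n + p))
    (fun z => phi z ^ S n - lam ^ S n * z ^ S n - INR (S n) * lam ^ n * mu * z ^ (S n + p))%C.
Proof.
intros Hp Hphi. induction n as [|n IH].
- apply vanishes_ext with (2 := Hphi). intros z _. simpl. ring.
- set (E := fun z => (phi z ^ S n - lam ^ S n * z ^ S n
               - INR (S n) * lam ^ n * mu * z ^ (S n + p))%C) in IH.
  set (E1 := fun z => (phi z - lam * z - mu * z ^ (S p))%C) in Hphi.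
  apply vanishes_ext with (fun z => (phi z * E z)
     + ((lam ^ S n * z ^ S n) * E1 z
     + ((INR (S n) * lam ^ n * mu * z ^ (S n + p)) * E1 z
     + (INR (S n) * lam ^ n * mu * mu) * z ^ (S n + p + S p))))%C.
  + intros z _. unfold E, E1. rewrite (S_INR (S n)), RtoC_plus. 
    rewrite ?Nat.add_succ_l, ?Cpow_S, ?Cpow_add_r, ?Cpow_S. ring.
  + apply vanishes_plus; [|apply vanishes_plus; [|apply vanishes_plus]].
    * apply vanishes_weaken with (1 + S (S n + p))%nat; [lia|].
      apply vanishes_mult; [apply (vanishes_of_expansion phi lam mu p Hphi)|exact IH].
    * apply vanishes_weaken with (S n + S (S p))%nat; [lia|].
      apply vanishes_mult; [apply vanishes_monomial|exact Hphi].
    * apply vanishes_weaken with (S n + p + S (S p))%nat; [lia|].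
      apply vanishes_mult; [apply vanishes_monomial|exact Hphi].
    (* The term quadratic in mu is of higher order because p >= 1. *)
    * apply vanishes_weaken with (S n + p + S p)%nat; [lia|].
      apply vanishes_monomial.
Qed.

(** The factor [INR (S n)] in the last formula is the heart of the matter:
    relative to the diagonal, this off-diagonal entry grows linearly in [n]. *)
Lemma coef_psi_pow (phi psi : C -> C) (lam mu : C) (p : nat) (a P : nat -> C) (n : nat) :
  (1 <= p)%nat ->
  vanishes_to_order (S (S p)) (fun z => phi z - lam * z - mu * z ^ (S p))%C ->
  power_series_on_disk psi a ->
  power_series_on_disk (fun z => psi z * phi z ^ S n)%C P ->
  (forall k, (k < S n)%nat -> P k = RtoC 0) /\
  P (S n) = (lam ^ S n * a 0%nat)%C /\
  P (S n + p)%nat = (lam ^ S n * a p + INR (S n) * lam ^ n * mu * a 0%nat)%C.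
Proof.
intros Hp Hphi Ha HP.
assert (H := coef_of_vanishes (S (S n + p))
  (fun z => psi z * phi z ^ S n + ((- lam ^ S n) * (z ^ S n * psi z)
     + (- (INR (S n) * lam ^ n * mu)) * (z ^ (S n + p) * psi z)))%C
  _ (power_series_plus _ _ _ _ HP
      (power_series_plus _ _ _ _
        (power_series_scal _ _ _ (power_series_shift (S n) psi a Ha))
        (power_series_scal _ _ _ (power_series_shift (S n + p) psi a Ha))))).
assert (Hv : vanishes_to_order (S (S n + p))
  (fun z => psi z * phi z ^ S n + ((- lam ^ S n) * (z ^ S n * psi z)
     + (- (INR (S n) * lam ^ n * mu)) * (z ^ (S n + p) * psi z)))%C).
{ apply vanishes_ext with (fun z => psi z * 
   (phi z ^ S n - lam ^ S n * z ^ S n - INR (S n) * lam ^ n * mu * z ^ (S n + p)))%C.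
  { intros z _. ring. }
  apply (vanishes_mult 0); [now apply power_series_bounded with a | now apply expansion_pow]. }
specialize (H Hv). cbv beta in H. repeat split.
- intros k Hk. specialize (H k ltac:(lia)).
  destruct (le_lt_dec (S n) k); [lia|]. destruct (le_lt_dec (S n + p) k); [lia|].
  rewrite <- H. ring.
- specialize (H (S n) ltac:(lia)).
  destruct (le_lt_dec (S n) (S n)); [|lia]. destruct (le_lt_dec (S n + p) (S n)); [lia|].
  rewrite Nat.sub_diag in H.
  apply Ceq_minus. rewrite <- H. ring.
- specialize (H (S n + p)%nat ltac:(lia)).
  destruct (le_lt_dec (S n) (S n + p)); [|lia].
  destruct (le_lt_dec (S n + p) (S n + p)); [|lia].
  rewrite Nat.sub_diag in H. replace (S n + p - S n)%nat with p in H by lia.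
  apply Ceq_minus. rewrite <- H. ring.
Qed.

(** After division by [lam^n] both terms on the left are independent of [n], while
    the right-hand side grows like [n |mu a0|]. When [lam = 0], the exponent
    [S n = 1] already works, as the left-hand side is zero. *)
Lemma off_diagonal_dominates (lam mu a0 ap : C) (p : nat) :
  mu <> RtoC 0 -> a0 <> RtoC 0 ->
  exists n : nat,
    Cmod (lam ^ S n * a0) + Cmod (lam ^ (S n + p) * a0) <
    Cmod (lam ^ S n * ap + INR (S n) * lam ^ n * mu * a0).
Proof.
intros Hmu Ha0.
assert (Hm : 0 < Cmod mu * Cmod a0) by (apply Rmult_lt_0_compat; now apply Cmod_gt_0).
destruct (Ceq_dec lam (RtoC 0)) as [->|Hl].
- exists 0%nat. 
  replace (RtoC 0 ^ 1 * a0)%C with (RtoC 0) by (simpl; ring).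
  replace (RtoC 0 ^ (1 + p) * a0)%C with (RtoC 0) by (simpl; ring).
  replace (RtoC 0 ^ 1 * ap + INR 1 * RtoC 0 ^ 0 * mu * a0)%C with (mu * a0)%C by (simpl; ring).
  rewrite Cmod_0, Cmod_mult. lra.
- assert (Hl0 : 0 < Cmod lam) by now apply Cmod_gt_0.
  set (K := Cmod lam * (Cmod a0 + Cmod (lam ^ p * a0) + Cmod ap)).
  destruct (INR_unbounded (K / (Cmod mu * Cmod a0))) as [n Hn].
  exists n.
  assert (HK : K < INR (S n) * (Cmod mu * Cmod a0)).
  { apply Rmult_gt_compat_r with (r := Cmod mu * Cmod a0) in Hn; [|lra].
    unfold Rdiv in Hn. rewrite Rmult_assoc, Rinv_l, Rmult_1_r in Hn by lra.
    rewrite S_INR. lra. }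
  replace (lam ^ S n * ap + INR (S n) * lam ^ n * mu * a0)%C
    with (lam ^ n * (INR (S n) * (mu * a0) - (- lam * ap)))%C by (simpl; ring).
  replace (lam ^ (S n + p) * a0)%C with (lam ^ n * (lam * (lam ^ p * a0)))%C
    by (simpl; rewrite Cpow_add_r; ring).
  replace (lam ^ S n * a0)%C with (lam ^ n * (lam * a0))%C by (simpl; ring).
  rewrite !(Cmod_mult (lam ^ n)), Cmod_pow.
  rewrite <- Rmult_plus_distr_l.
  apply Rmult_lt_compat_l; [now apply pow_lt|].
  assert (Htri : Cmod (INR (S n) * (mu * a0)) <=
     Cmod (INR (S n) * (mu * a0) - - lam * ap) + Cmod (- lam * ap)).
  { eapply Rle_trans; [|apply Cmod_triangle]. right. f_equal. ring. }
  revert Htri. rewrite (Cmod_mult (- lam)), Cmod_opp, (Cmod_mult (INR (S n))), Cmod_R.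
  rewrite Rabs_pos_eq by apply pos_INR. 
  rewrite (Cmod_mult mu), (Cmod_mult lam a0), (Cmod_mult lam (lam ^ p * a0)).
  unfold K in HK. lra.
Qed.

(** * An identity theorem for power series *)

(** The binomial coefficient [k + n] over [n], times [e^n], is one term of the
    expansion of [(1 + e)^(k + n)]; the induction is Pascal's rule. *)
Lemma fact_add_bound (e : R) (k n : nat) : 0 < e ->
  INR (fact (k + n)) * e ^ n <= INR (fact k) * INR (fact n) * (1 + e) ^ (k + n).
Proof.
intros He. remember (k + n)%nat as m eqn:Hm. revert k n Hm.
induction m as [|m IH]; intros k n Hm.
{ replace k with 0%nat by lia. replace n with 0%nat by lia. simpl. lra. }
assert (Hpos : forall i, 0 < INR (fact i)) by (intros i; apply INR_fact_lt_0).
assert (Hf : forall i, INR (fact (S i)) = INR (S i) * INR (fact i)).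
{ intros i. now rewrite <- mult_INR. }
destruct n as [|n].
{ replace k with (S m) by lia. change (INR (fact 0)) with 1. rewrite pow_O, !Rmult_1_r.
  rewrite <- (Rmult_1_r (INR (fact (S m)))) at 1.
  apply Rmult_le_compat_l; [apply Rlt_le, Hpos|]. apply pow_R1_Rle. lra. }
destruct k as [|k].
{ replace (S n) with (S m) by lia. change (INR (fact 0)) with 1. rewrite Rmult_1_l.
  apply Rmult_le_compat_l; [apply Rlt_le, Hpos|]. apply pow_incr. lra. }
assert (H1 := IH k (S n) ltac:(lia)).
assert (H2 := IH (S k) n ltac:(lia)).
rewrite (Hf m). replace (INR (S m)) with (INR (S k) + INR (S n))
  by (rewrite <- plus_INR; f_equal; lia).
apply Rmult_le_compat_l with (r := INR (S k)) in H1; [|apply pos_INR].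
apply Rmult_le_compat_l with (r := INR (S n) * e) in H2;
  [|apply Rmult_le_pos; [apply pos_INR|lra]].
rewrite (Hf k), (Hf n) in *. simpl pow in *. nra.
Qed.

Lemma CV_radius_bounded_coef (b : nat -> R) (M x : R) :
  (forall n, Rabs (b n) <= M) -> Rabs x < 1 -> Rbar_lt (Rabs x) (CV_radius b).
Proof.
intros Hb Hx. apply Rbar_lt_le_trans with 1; [simpl; lra|].
apply (proj1 (CV_radius_bounded b)). exists M. intros n.
rewrite pow1, Rmult_1_r. apply Hb.
Qed.

(** A Cauchy estimate obtained from the coefficients alone, uniform on [[-s, s]].
    It comes from summing the geometric series that [fact_add_bound] provides
    for the differentiated power series. *)
Lemma Derive_n_PSeries_bound (b : nat -> R) (M s : R) :
  (forall n, Rabs (b n) <= M) -> 0 < s < 1 ->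
  exists A K, 0 <= A /\ 0 < K /\ forall n x, Rabs x <= s ->
    Rabs (Derive_n (PSeries b) n x) <= A * (INR (fact n) * K ^ n).
Proof.
intros Hb Hs.
(* This choice of e keeps the ratio (1 + e) s below 1. *)
set (e := (1 - s) / 2). set (q := (1 + e) * s).
assert (He : 0 < e) by (unfold e; lra).
assert (Hq : 0 < q < 1) by (unfold q, e; split; nra).
exists (M * / (1 - q)), ((1 + e) / e).
assert (HM : 0 <= M) by (eapply Rle_trans; [apply Rabs_pos | apply (Hb 0%nat)]).
split; [apply Rmult_le_pos; [assumption|left; apply Rinv_0_lt_compat; lra]|].
split; [apply Rdiv_lt_0_compat; lra|].
intros n x Hx.
rewrite Derive_n_PSeries by (apply (CV_radius_bounded_coef b M); [exact Hb|lra]).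
set (B := M * (INR (fact n) * ((1 + e) / e) ^ n)).
assert (Hg : is_series (fun k => B * q ^ k) (B * / (1 - q)))
  by exact (is_series_scal B _ _ (is_series_geom q ltac:(rewrite Rabs_pos_eq; lra))).
replace (M * / (1 - q) * (INR (fact n) * ((1 + e) / e) ^ n)) with (B * / (1 - q))
  by (unfold B; ring).
assert (Hterm : forall k, Rabs (PS_derive_n n b k * x ^ k) <= B * q ^ k).
{ intros k. unfold PS_derive_n, B, q.
  assert (Hk := INR_fact_lt_0 k). assert (Hn := INR_fact_lt_0 n).
  assert (Hkn := INR_fact_lt_0 (k + n)).
  rewrite !Rabs_mult, <- RPow_abs, (Rabs_pos_eq (_ / _)) by (apply Rlt_le, Rdiv_lt_0_compat; lra).
  assert (Hen : 0 < e ^ n) by now apply pow_lt.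
  assert (Hfact : INR (fact (k + n)) / INR (fact k) <=
            INR (fact n) * ((1 + e) / e) ^ n * (1 + e) ^ k).
  { unfold Rdiv at 2. rewrite Rpow_mult_distr, pow_inv.
    apply Rmult_le_reg_r with (INR (fact k) * e ^ n); [now apply Rmult_lt_0_compat|].
    replace (INR (fact (k + n)) / INR (fact k) * (INR (fact k) * e ^ n))
      with (INR (fact (k + n)) * e ^ n) by (field; lra).
    eapply Rle_trans; [now apply fact_add_bound|]. rewrite pow_add. right. field. lra. }
  assert (Hxk : Rabs x ^ k <= s ^ k) by (apply pow_incr; split; [apply Rabs_pos|assumption]).
  rewrite Rpow_mult_distr.
  replace (M * (INR (fact n) * ((1 + e) / e) ^ n) * ((1 + e) ^ k * s ^ k))
    with ((INR (fact n) * ((1 + e) / e) ^ n * (1 + e) ^ k) * M * s ^ k) by ring.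
  apply Rmult_le_compat.
  - apply Rmult_le_pos; [apply Rlt_le, Rdiv_lt_0_compat; lra | apply Rabs_pos].
  - apply pow_le, Rabs_pos.
  - apply Rmult_le_compat; [apply Rlt_le, Rdiv_lt_0_compat; lra | apply Rabs_pos | assumption | apply Hb].
  - assumption. }
assert (Hex : ex_series (fun k => Rabs (PS_derive_n n b k * x ^ k))).
{ apply (ex_series_le (V := R_CompleteNormedModule) _ (fun k => B * q ^ k)).
  - intros k. change (Rabs (Rabs (PS_derive_n n b k * x ^ k)) <= B * q ^ k).
    rewrite Rabs_Rabsolu. apply Hterm.
  - eexists. exact Hg. }
unfold PSeries. eapply Rle_trans; [now apply Series_Rabs|].
rewrite <- (is_series_unique _ _ Hg).
apply Series_le.
- intros k. split; [apply Rabs_pos|apply Hterm].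
- eexists. exact Hg.
Qed.

(** The gain [d] depends only on the constant [K] of the Cauchy estimate: at a point
    of the zero interval all derivatives vanish, and the Taylor remainder at
    distance at most [2 d] is a power of [2 d K <= 1/2]. *)
Lemma real_power_series_zero_extends (b : nat -> R) (M s : R) :
  (forall n, Rabs (b n) <= M) -> 0 < s < 1 ->
  exists d, 0 < d /\ forall u w, - s <= u < w ->
    (forall x, u < x < w -> x < s -> PSeries b x = 0) ->
    (forall x, u < x < w + d -> x < s -> PSeries b x = 0).
Proof.
intros Hb Hs. destruct (Derive_n_PSeries_bound b M s Hb Hs) as (A & K & HA & HK & Hbound).
assert (Hd : 0 < / (4 * K)) by (apply Rinv_0_lt_compat; lra).
exists (/ (4 * K)). split; [assumption|].
intros u w Huw Hz x Hx Hxs.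
destruct (Rlt_dec x w) as [Hxw|Hxw]; [apply Hz; lra|]. apply Rnot_lt_le in Hxw.
(* The centre y lies in the zero interval, within d of its right end. *)
set (y := Rmax ((u + w) / 2) (w - / (4 * K))).
assert (Hy1 : u < y). { pose proof (Rmax_l ((u + w) / 2) (w - / (4 * K))). unfold y; lra. }
assert (Hy2 : y < w). { unfold y. apply Rmax_lub_lt; lra. }
assert (Hyx : 0 <= (x - y) * K <= / 2).
{ pose proof (Rmax_r ((u + w) / 2) (w - / (4 * K))) as H. fold y in H.
  split; [apply Rmult_le_pos; lra|].
  replace (/ 2) with ((2 * / (4 * K)) * K) by (field; lra).
  apply Rmult_le_compat_r; lra. }
assert (Hder : forall m, Derive_n (PSeries b) m y = 0).
{ intros m. rewrite (Derive_n_ext_loc _ (fun _ => 0)).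
  - destruct m; [reflexivity | apply Derive_n_const].
  - assert (He : 0 < Rmin (y - u) (w - y)) by (apply Rmin_pos; lra).
    exists (mkposreal _ He). intros v Hv.
    change (Rabs (v - y) < Rmin (y - u) (w - y)) in Hv.
    pose proof (Rmin_l (y - u) (w - y)). pose proof (Rmin_r (y - u) (w - y)).
    apply Rabs_def2 in Hv. apply Hz; lra. }
assert (Hsmall : forall n, Rabs (PSeries b x) <= A * / 2 ^ n).
{ intros n.
  destruct (Taylor_Lagrange (PSeries b) n y x ltac:(lra)) as (z & Hzx & ->).
  { intros t Ht k _. apply ex_derive_n_PSeries, (CV_radius_bounded_coef b M); [exact Hb|].
    apply Rabs_def1; lra. }
  rewrite (sum_eq_R0 _ n) by (intros m _; rewrite Hder; ring).
  rewrite Rplus_0_l, Rabs_mult.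
  assert (Hf := INR_fact_lt_0 (S n)).
  assert (Hxy : 0 <= (x - y) ^ S n) by (apply pow_le; lra).
  rewrite Rabs_pos_eq by (apply Rdiv_le_0_compat; assumption).
  eapply Rle_trans; [apply Rmult_le_compat_l; 
     [now apply Rdiv_le_0_compat | apply Hbound; apply Rabs_le; lra]|].
  replace ((x - y) ^ S n / INR (fact (S n)) * (A * (INR (fact (S n)) * K ^ S n)))
    with (A * ((x - y) * K) ^ S n) by (rewrite Rpow_mult_distr; field; lra).
  apply Rmult_le_compat_l; [assumption|].
  eapply Rle_trans; [apply pow_incr; exact Hyx|].
  rewrite <- pow_inv. simpl. assert (0 < (/2)^n) by (apply pow_lt; lra). lra. }
destruct (Req_dec (PSeries b x) 0) as [E|E]; [assumption|exfalso].
apply Rabs_pos_lt in E.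
destruct (INR_unbounded (A / Rabs (PSeries b x))) as [n Hn].
assert (H2n : INR n < 2 ^ n).
{ clear. induction n as [|n IH]; [simpl; lra|]. rewrite S_INR. simpl.
  assert (1 <= 2 ^ n) by (apply pow_R1_Rle; lra). lra. }
specialize (Hsmall n).
assert (0 < 2 ^ n) by (apply pow_lt; lra).
apply Rmult_le_compat_r with (r := 2 ^ n) in Hsmall; [|lra].
rewrite Rmult_assoc, Rinv_l, Rmult_1_r in Hsmall by lra.
apply Rmult_gt_compat_r with (r := Rabs (PSeries b x)) in Hn; [|lra].
unfold Rdiv in Hn. rewrite Rmult_assoc, Rinv_l, Rmult_1_r in Hn by lra. nra.
Qed.

Lemma real_power_series_zero (b : nat -> R) (M s u w : R) :
  (forall n, Rabs (b n) <= M) -> 0 < s < 1 -> - s <= u < w -> u < 0 ->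
  (forall x, u < x < w -> x < s -> PSeries b x = 0) -> b 0%nat = 0.
Proof.
intros Hb Hs Huw Hu Hz.
destruct (real_power_series_zero_extends b M s Hb Hs) as (d & Hd & Hext).
assert (H : forall n x, u < x < w + INR n * d -> x < s -> PSeries b x = 0).
{ induction n as [|n IH]; intros x Hx.
  - apply Hz. simpl in Hx. lra.
  - apply (Hext u (w + INR n * d)); [|exact IH|].
    + pose proof (pos_INR n). nra.
    + rewrite S_INR in Hx. lra. }
destruct (INR_unbounded (- w / d)) as [n Hn].
rewrite <- PSeries_0. apply (H n); [|lra]. split; [lra|].
apply Rmult_gt_compat_r with (r := d) in Hn; [|lra].
unfold Rdiv in Hn. rewrite Rmult_assoc, Rinv_l, Rmult_1_r in Hn by lra. lra.
Qed.

(** Restriction to the diameter through [z0] gives a real power series. The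
    parameter is [x -> x z1] with [z1] on the opposite side of the origin, so
    that [z0] has negative parameter and zeros propagate to the right, which is
    the direction of the Taylor formula. As [z1] lies beyond [-z0] but still inside
    the disk, the coefficients [Re (a_n z1^n)] are bounded and [z0] stays away from
    the end of the interval. *)
Lemma identity_Re (f : C -> C) (a : nat -> C) (z0 : C) (eta : R) :
  power_series_on_disk f a -> unit_disk z0 -> z0 <> RtoC 0 -> 0 < eta ->
  (forall z, Cmod (z - z0) < eta -> f z = RtoC 0) -> Re (a 0%nat) = 0.
Proof.
intros Hf Hz0 Hnz Heta Hzero. unfold unit_disk in Hz0.
assert (Hr : 0 < Cmod z0) by now apply Cmod_gt_0.
rewrite power_series_iff in Hf.
set (r := Cmod z0) in *. set (tau := (1 + r) / (2 * r)).
assert (Htau : 1 < tau).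
{ unfold tau. apply Rmult_lt_reg_r with (2 * r); [lra|].
  unfold Rdiv. rewrite Rmult_assoc, Rinv_l by lra. lra. }
set (z1 := (RtoC (- tau) * z0)%C).
assert (Hz1 : Cmod z1 < 1).
{ unfold z1. rewrite Cmod_mult, Cmod_R, Rabs_Ropp, Rabs_pos_eq by lra. fold r.
  unfold tau. replace ((1 + r) / (2 * r) * r) with ((1 + r) / 2) by (field; lra). lra. }
set (b := fun n => Re (z1 ^ n * a n)%C).
assert (HPS : forall x, Rabs x <= 1 -> PSeries b x = Re (f (x * z1)%C)).
{ intros x Hx. apply is_pseries_unique, is_pseries_R.
  apply is_series_ext with (fun n => Re ((x * z1) ^ n * a n)%C).
  - intros n. unfold b. rewrite Cpow_mult_l, <- Cmult_assoc, <- RtoC_pow, re_scal_l.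
    apply Rmult_comm.
  - apply is_series_Re, Hf. unfold unit_disk.
    rewrite Cmod_mult, Cmod_R. pose proof (Cmod_ge_0 z1). pose proof (Rabs_pos x). nra. }
destruct (is_seriesC_bounded _ _ (Hf z1 Hz1)) as [M HM].
assert (Hb : forall n, Rabs (b n) <= M).
{ intros n. eapply Rle_trans; [apply re_le_Cmod|apply HM]. }
replace (Re (a 0%nat)) with (b 0%nat) by (unfold b; f_equal; simpl; ring).
set (x0 := - / tau).
assert (Htau1 : 0 < / tau < 1).
{ split; [apply Rinv_0_lt_compat; lra|]. rewrite <- Rinv_1. apply Rinv_lt_contravar; lra. }
set (s := (1 + / tau) / 2).
assert (Hs : 0 < s < 1) by (unfold s; lra).
set (u := Rmax (x0 - eta) (- s)).
apply (real_power_series_zero b M s u (x0 + eta) Hb Hs).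
- split; [apply Rmax_r|]. unfold u, s, x0. apply Rmax_lub_lt; lra.
- unfold u, x0. apply Rmax_lub_lt; lra.
- intros x Hx Hxs.
  assert (H1 := Rmax_l (x0 - eta) (- s)). assert (H2 := Rmax_r (x0 - eta) (- s)).
  fold u in H1, H2.
  rewrite HPS by (apply Rabs_le; lra).
  rewrite Hzero; [apply re_RtoC|].
  replace (x * z1 - z0)%C with (RtoC (x - x0) * z1)%C.
  + rewrite Cmod_mult, Cmod_R.
    assert (Rabs (x - x0) < eta) by (apply Rabs_def1; lra).
    pose proof (Rabs_pos (x - x0)). pose proof (Cmod_ge_0 z1). nra.
  + assert (Hz01 : (RtoC x0 * z1)%C = z0).
    { unfold z1, x0. rewrite Cmult_assoc, <- RtoC_mult.
      replace (- / tau * - tau) with 1 by (field; lra). ring. }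
    rewrite <- Hz01 at 1. rewrite RtoC_minus. ring.
Qed.

Lemma identity_at_0 (f : C -> C) (a : nat -> C) (z0 : C) (eta : R) :
  power_series_on_disk f a -> unit_disk z0 -> 0 < eta ->
  (forall z, Cmod (z - z0) < eta -> f z = RtoC 0) -> a 0%nat = RtoC 0.
Proof.
intros Hf Hz0 Heta Hzero.
destruct (Ceq_dec z0 (RtoC 0)) as [->|Hnz].
{ rewrite <- (power_series_at_0 f a Hf). apply Hzero.
  replace (0 - 0)%C with (RtoC 0) by ring. now rewrite Cmod_0. }
assert (H1 := identity_Re f a z0 eta Hf Hz0 Hnz Heta Hzero).
assert (H2 := identity_Re _ _ z0 eta (power_series_scal Ci f a Hf) Hz0 Hnz Heta).
cbv beta in H2. rewrite (Cmult_comm Ci (a 0%nat)), re_mult_Ci in H2.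
apply injective_projections; [exact H1|].
change (Im (a 0%nat) = 0). 
rewrite <- (Ropp_involutive (Im (a 0%nat))), H2; [apply Ropp_0|].
intros z Hz. rewrite (Hzero z Hz). ring.
Qed.

(** * Recovering phi from psi phi *)

Lemma nonzero_near (h : C -> C) (z0 : C) :
  ex_derive (K := C_AbsRing) (V := C_NormedModule) h z0 -> h z0 <> RtoC 0 ->
  exists eta, 0 < eta /\ forall z, Cmod (z - z0) < eta -> h z <> RtoC 0.
Proof.
intros Hd Hnz. apply ex_derive_continuous in Hd.
assert (Hpos : 0 < Cmod (h z0) / 2) by (apply Cmod_gt_0 in Hnz; lra).
assert (Hloc : locally (T := C_NormedModule) (h z0) (fun v => v <> RtoC 0)).
{ exists (mkposreal _ Hpos). intros v [H1 H2] Hv. rewrite Hv in H1, H2.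
  change (Rabs (0 - Re (h z0)) < Cmod (h z0) / 2) in H1.
  change (Rabs (0 - Im (h z0)) < Cmod (h z0) / 2) in H2.
  rewrite Rminus_0_l, Rabs_Ropp in H1, H2.
  pose proof (Cmod_le_Re_Im (h z0)). lra. }
destruct (Hd _ Hloc) as [eta Heta].
exists eta. split; [apply cond_pos|]. intros z Hz. apply Heta. exact Hz.
Qed.

Lemma vanishes_of_derivable (h : C -> C) :
  ex_derive (K := C_AbsRing) (V := C_NormedModule) h (RtoC 0) -> h (RtoC 0) = RtoC 0 ->
  vanishes_to_order 1 h.
Proof.
intros [l [_ Hl]] H0.
destruct (Hl (RtoC 0) (fun P HP => HP) (mkposreal 1 Rlt_0_1)) as [d Hd].
exists (1 + Cmod l), d. split; [apply cond_pos|]. intros z Hz.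
assert (Hb : Cmod (z - 0) < d) by (replace (z - 0)%C with z by ring; lra).
specialize (Hd z Hb).
change (Cmod ((h z - h (RtoC 0)) - (z - 0) * l)%C <= 1 * Cmod (z - 0)%C) in Hd.
rewrite H0 in Hd.
replace (z - 0)%C with z in Hd by ring.
replace (h z - 0 - z * l)%C with (h z - z * l)%C in Hd by ring.
assert (Htri := Cmod_triangle (h z - z * l) (z * l)).
replace (h z - z * l + z * l)%C with (h z) in Htri by ring.
rewrite Cmod_mult in Htri. rewrite pow_1. lra.
Qed.

Lemma vanishes_pow (h : C -> C) (k : nat) :
  vanishes_to_order 1 h -> vanishes_to_order k (fun z => h z ^ k)%C.
Proof.
intros H. induction k as [|k IH]; [exact (vanishes_const (RtoC 1))|].
exact (vanishes_mult 1 k _ _ H IH).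
Qed.

(** [f] is bounded away from zero near the origin, where it tends to [a_0]. *)
Lemma vanishes_cancel (N : nat) (f g : C -> C) (a : nat -> C) :
  power_series_on_disk f a -> a 0%nat <> RtoC 0 ->
  vanishes_to_order N (fun z => f z * g z)%C -> vanishes_to_order N g.
Proof.
intros Hf Ha Hfg.
assert (H1 := vanishes_leading_term 0 f a Hf ltac:(intros; lia)).
destruct (vanishes_bound_nonneg _ _ H1) as (M1 & d1 & HM1 & Hd1 & Hb1).
destruct (vanishes_bound_nonneg _ _ Hfg) as (M2 & d2 & HM2 & Hd2 & Hb2).
assert (Ha0 : 0 < Cmod (a 0%nat)) by now apply Cmod_gt_0.
assert (Hd3 : 0 < Cmod (a 0%nat) / (2 * (M1 + 1))) by (apply Rdiv_lt_0_compat; lra).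
set (d3 := Cmod (a 0%nat) / (2 * (M1 + 1))) in *.
exists (M2 / (Cmod (a 0%nat) / 2)), (Rmin d3 (Rmin d1 d2)).
split; [repeat apply Rmin_pos; lra|]. intros z Hz.
pose proof (Rmin_l d3 (Rmin d1 d2)). pose proof (Rmin_r d3 (Rmin d1 d2)).
pose proof (Rmin_l d1 d2). pose proof (Rmin_r d1 d2).
specialize (Hb1 z ltac:(lra)). specialize (Hb2 z ltac:(lra)).
rewrite pow_1 in Hb1. replace (a 0%nat * z ^ 0)%C with (a 0%nat) in Hb1 by (simpl; ring).
assert (HM : M1 * Cmod z <= Cmod (a 0%nat) / 2).
{ replace (Cmod (a 0%nat) / 2) with ((M1 + 1) * d3) by (unfold d3; field; lra). nra. }
assert (Hfz : Cmod (a 0%nat) / 2 <= Cmod (f z)).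
{ assert (Htri := Cmod_triangle (f z) (- (f z - a 0%nat))).
  replace (f z + - (f z - a 0%nat))%C with (a 0%nat) in Htri by ring.
  rewrite Cmod_opp in Htri. lra. }
rewrite Cmod_mult in Hb2.
apply Rmult_le_reg_l with (Cmod (a 0%nat) / 2); [lra|].
replace (Cmod (a 0%nat) / 2 * (M2 / (Cmod (a 0%nat) / 2) * Cmod z ^ N))
  with (M2 * Cmod z ^ N) by (field; lra).
eapply Rle_trans; [|exact Hb2].
apply Rmult_le_compat_r; [apply Cmod_ge_0|assumption].
Qed.

Lemma power_series_zero_coef (f : C -> C) (a : nat -> C) :
  power_series_on_disk f a -> (forall k, a k = RtoC 0) ->
  forall z, unit_disk z -> f z = RtoC 0.
Proof.
intros Hf Ha z Hz. rewrite power_series_iff in Hf.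
apply (is_seriesC_unique _ _ _ (Hf z Hz)).
assert (H := is_seriesC_single (fun n => z ^ n * a n)%C 0).
cbv beta in H. rewrite (Ha 0%nat), Cmult_0_r in H. apply H.
intros k _. rewrite Ha. ring.
Qed.

(** At a point where [phi] differs from [lam z] it does so in a neighbourhood, by
    continuity; there [psi] would vanish, hence [psi] would vanish at the origin by
    the identity theorem. Finally [|lam| <= 1], since otherwise [phi] would take the
    value 1 at [1 / lam]. *)
Lemma dilation_of_factor (phi psi : C -> C) (a : nat -> C) (lam : C) :
  holomorphic_on_disk phi -> (forall z, unit_disk z -> unit_disk (phi z)) ->
  power_series_on_disk psi a -> a 0%nat <> RtoC 0 ->
  (forall z, unit_disk z -> psi z * (phi z - lam * z) = 0)%C ->
  is_dilation phi.
Proof.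
intros Hphi Hself Ha Ha0 Hprod.
assert (Hlin : forall z, unit_disk z -> phi z = (lam * z)%C).
{ intros z0 Hz0. apply NNPP. intros Hne.
  destruct (nonzero_near (fun z => phi z - lam * z ^ 1)%C z0) as (eta & Heta & Hnz).
  - apply (ex_derive_minus (K := C_AbsRing) (V := C_NormedModule) phi
             (fun z => lam * z ^ 1)%C); [now apply Hphi|apply ex_derive_C_monomial].
  - rewrite Cpow_1_r. now apply Cminus_eq_contra.
  - apply Ha0.
    assert (He : 0 < Rmin eta (1 - Cmod z0)) by (unfold unit_disk in Hz0; apply Rmin_pos; lra).
    apply (identity_at_0 psi a z0 _ Ha Hz0 He).
    intros z Hz. pose proof (Rmin_l eta (1 - Cmod z0)). pose proof (Rmin_r eta (1 - Cmod z0)).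
    apply NNPP. intros Hpsi.
    apply (Cmult_neq_0 _ _ Hpsi (Hnz z ltac:(lra))). rewrite Cpow_1_r. apply Hprod.
    assert (Htri := Cmod_triangle (z - z0) z0).
    replace (z - z0 + z0)%C with z in Htri by ring. unfold unit_disk. lra. }
exists lam. split; [|exact Hlin].
apply Rnot_lt_le. intros Hlt.
assert (Hl0 : lam <> RtoC 0) by (apply Cmod_gt_0; lra).
assert (Hd : unit_disk (/ lam)%C).
{ unfold unit_disk. rewrite Cmod_inv by assumption. rewrite <- Rinv_1.
  apply Rinv_lt_contravar; lra. }
assert (H1 := Hself _ Hd). rewrite (Hlin _ Hd), Cinv_r in H1 by assumption.
unfold unit_disk in H1. rewrite Cmod_1 in H1. lra.
Qed.

Lemma first_nonzero_coef (a : nat -> C) :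
  ~ (forall k, a k = RtoC 0) ->
  exists k, a k <> RtoC 0 /\ forall i, (i < k)%nat -> a i = RtoC 0.
Proof.
intros H. apply not_all_ex_not in H.
destruct (dec_inh_nat_subset_has_unique_least_element (fun k => a k <> RtoC 0)) as (k & [Hk Hm] & _).
- intros n. destruct (Ceq_dec (a n) (RtoC 0)); [right|left]; tauto.
- exact H.
- exists k. split; [assumption|]. intros i Hi. apply NNPP. intros Hne.
  specialize (Hm i Hne). lia.
Qed.

(** [psi] and [psi phi] have power series on the disk as images of elements of the
    Dirichlet space, and the expansion of [phi] is read off from them without
    Cauchy's integral formula, through [psi (phi - lam z)]: with the choice
    [lam = Q_1 / a_0] its coefficients of order 0 and 1 vanish, and its first nonzero
    term, divided by [a_0], is the first nonlinear term of [phi]. *)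
Lemma expansion_of_product_series (phi psi : C -> C) (a Q : nat -> C) :
  phi (RtoC 0) = RtoC 0 ->
  power_series_on_disk psi a -> a 0%nat <> RtoC 0 ->
  power_series_on_disk (fun z => psi z * phi z)%C Q ->
  (exists lam, forall z, unit_disk z -> (psi z * (phi z - lam * z) = 0)%C) \/
  (exists lam mu p, (1 <= p)%nat /\ mu <> RtoC 0 /\
    vanishes_to_order (S (S p)) (fun z => phi z - lam * z - mu * z ^ (S p))%C).
Proof.
intros Hphi0 Ha Ha0 HQ.
set (lam := (Q 1%nat / a 0%nat)%C).
assert (HS := power_series_plus _ _ _ _ HQ
   (power_series_scal (- lam) _ _ (power_series_shift 1 psi a Ha))).
set (s := fun k : nat => (Q k + - lam * (if le_lt_dec 1 k then a (k - 1)%nat else RtoC 0))%C).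
change (power_series_on_disk (fun z => psi z * phi z + - lam * (z ^ 1 * psi z))%C s) in HS.
destruct (classic (forall k, s k = RtoC 0)) as [Hs|Hs].
- left. exists lam. intros z Hz.
  rewrite <- (power_series_zero_coef _ s HS Hs z Hz), Cpow_1_r. ring.
- right. destruct (first_nonzero_coef s Hs) as (k & Hk & Hlow).
  assert (Hs0 : s 0%nat = RtoC 0).
  { rewrite <- (power_series_at_0 _ _ HS), Hphi0. simpl. ring. }
  assert (Hs1 : s 1%nat = RtoC 0).
  { unfold s, lam. simpl. field. assumption. }
  destruct k as [|[|p]]; [contradiction|contradiction|].
  exists lam, (s (S (S p)) / a 0%nat)%C, (S p).
  set (mu := (s (S (S p)) / a 0%nat)%C).
  assert (Hmu : (mu * a 0%nat)%C = s (S (S p))) by (unfold mu; field; assumption).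
  split; [lia|]. split.
  { intros E. apply Hk. rewrite <- Hmu, E. ring. }
  apply (vanishes_cancel _ psi _ a Ha Ha0).
  apply vanishes_ext with (fun z =>
    (psi z * phi z + - lam * (z ^ 1 * psi z) - s (S (S p)) * z ^ S (S p))
    + (- mu * z ^ S (S p)) * (psi z - a 0%nat * z ^ 0))%C.
  { intros z _. rewrite <- Hmu, Cpow_1_r.
    replace (z ^ 0)%C with (RtoC 1) by reflexivity. ring. }
  apply vanishes_plus; [now apply (vanishes_leading_term _ _ s HS)|].
  apply vanishes_weaken with (S (S p) + 1)%nat; [lia|].
  apply vanishes_mult; [apply vanishes_monomial|].
  apply vanishes_leading_term; [assumption|intros; lia].
Qed.

(** * The numerical range of the operator *)

Theorem theorem3p6 (phi psi : C -> C)
  (hphi : holomorphic_on_disk phi)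
  (hphi_self : forall z : C, unit_disk z -> unit_disk (phi z))
  (hpsi : holomorphic_on_disk psi)
  (hbounded : bounded_on_dirichlet (weighted_composition psi phi))
  (hpsi_nonzero : exists z : C, unit_disk z /\ psi z <> RtoC 0)
  (hphi_zero : phi (RtoC 0) = RtoC 0)
  (hphi_not_dilation : ~ is_dilation phi) :
  interior_point (numerical_range (weighted_composition psi phi)) (RtoC 0).
Proof.
(* psi phi^n is the image of z^n, hence lies in the space and has a power
   series. *)
assert (Hser : forall n, exists P, power_series_on_disk (fun z => psi z * phi z ^ n)%C P).
{ intros n. destruct hbounded as [Hin _].
  destruct (Hin _ (in_dirichlet_two_terms (RtoC 1) (RtoC 0) n 0)) as (_ & P & HP & _).
  exists P. apply power_series_ext with (3 := HP); [|reflexivity].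
  intros z _. unfold weighted_composition, two_terms. ring. }
destruct (Hser 0%nat) as [a Ha0].
assert (Ha : power_series_on_disk psi a).
{ apply power_series_ext with (3 := Ha0); [|reflexivity]. intros z _. simpl. ring. }
destruct (Ceq_dec (a 0%nat) (RtoC 0)) as [E|E].
(* psi 0 = 0: the diagonal is zero, and the first column is not. *)
- destruct (first_nonzero_coef a) as (k & Hk & Hlow).
  { intros Hall. destruct hpsi_nonzero as (z & Hz & Hnz). apply Hnz.
    now apply (power_series_zero_coef psi a). }
  destruct (Hser k) as [Q HQ].
  assert (HQ0 := coef_of_vanishes (1 + k) _ Q HQ).
  assert (HvQ : vanishes_to_order (1 + k) (fun z => psi z * phi z ^ k)%C).
  { apply vanishes_mult.
    - apply (vanishes_of_coef 1 psi a Ha). intros i Hi. now replace i with 0%nat by lia.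
    - apply vanishes_pow, vanishes_of_derivable; [|assumption].
      apply hphi. unfold unit_disk. rewrite Cmod_0. lra. }
  apply (interior_of_lower_triangular_pair phi psi 0 k a Q).
  + destruct k; [contradiction|lia].
  + exact Ha0.
  + exact HQ.
  + apply HQ0; [exact HvQ|lia].
  + rewrite E, (HQ0 HvQ k) by lia. rewrite Cmod_0, Rplus_0_r. now apply Cmod_gt_0.
(* psi 0 <> 0: a column of large index is used. *)
- destruct (Hser 1%nat) as [Q1 HQ1].
  assert (HQ1' : power_series_on_disk (fun z => psi z * phi z)%C Q1).
  { apply power_series_ext with (3 := HQ1); [|reflexivity]. intros z _. now rewrite Cpow_1_r. }
  destruct (expansion_of_product_series phi psi a Q1 hphi_zero Ha E HQ1')
    as [[lam Hlam]|(lam & mu & p & Hp & Hmu & Hexp)].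
  { exfalso. apply hphi_not_dilation. now apply (dilation_of_factor phi psi a lam). }
  destruct (off_diagonal_dominates lam mu (a 0%nat) (a p) p Hmu E) as [n Hn].
  destruct (Hser (S n)) as [P HP]. destruct (Hser (S n + p)%nat) as [Q HQ].
  destruct (coef_psi_pow phi psi lam mu p a P n Hp Hexp Ha HP) as (_ & HPd & HPo).
  destruct (coef_psi_pow phi psi lam mu p a Q (n + p) Hp Hexp Ha HQ) as (HQlow & HQd & _).
  apply (interior_of_lower_triangular_pair phi psi (S n) (S n + p) P Q);
    [lia|assumption|assumption|apply HQlow; lia|].
  change (S (n + p)) with (S n + p)%nat in HQd.
  now rewrite HPd, HQd, HPo.
Qed.
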